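(* For $n\ge1$, with the extra variable $t_0$ renamed $t_{n+1}$, $$\widetilde C_n(t_{n+1},t_1,\dots,t_n)=\sum_{u\in S_n}\prod_{i=1}^n\left(t_i^{\chi(u_{i-1}<u_i)}+t_{i+1}^{\chi(u_i>u_{i+1})}\right),$$ using the convention $u_0=u_{n+1}=0$.
   Context: $S_n$ is the symmetric group on $\{1,\dots,n\}$, with permutations written $u=u_1\cdots u_n$. $\chi(S)=1$ if the statement $S$ is true and $0$ if it is false. The Weyl group $C_n$ is the group of signed permutations: permutations $w$ of $\{\pm1,\dots,\pm n\}$ with $w(-i)=-w(i)$, written $w=w_1\cdots w_n$ with $w_i=w(i)$. The simple roots are $\alpha_1=2\varepsilon_1$, $\alpha_i=\varepsilon_i-\varepsilon_{i-1}$ ($2\le i\le n$), and the lowest root is $\alpha_0=-2\varepsilon_n$. The affine descent set $\widetilde{\mathrm{Des}}(w)\subseteq\{0,1,\dots,n\}$ of $w\in C_n$ consists of all $i\in\{1,\dots,n\}$ with $w_{i-1}>w_i$ (convention $w_0=0$), together with $0$ if $w_n>0$. The multivariate affine Eulerian polynomial is $\widetilde C_n(t_0,t_1,\dots,t_n)=\sum_{w\in C_n}\prod_{i\in\widetilde{\mathrm{Des}}(w)}t_i$. *)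

(* Defs.v *)
From HB Require Import structures.
From mathcomp Require Export all_boot all_order all_fingroup all_algebra.
From mathcomp Require Export mpoly.

Set Implicit Arguments.
Unset Strict Implicit.
Unset Printing Implicit Defensive.

Import Order.TTheory GRing.Theory Num.Theory.
Local Open Scope ring_scope.

(* The set {+-1, ..., +-n}: the pair (k, s) stands for k + 1 if s = false and
   for -(k + 1) if s = true. *)
Definition signed_letter (n : nat) : finType := ('I_n * bool)%type.

Definition letter_val (n : nat) (x : signed_letter n) : int :=
  (-1) ^+ x.2 * (x.1.+1)%:Z.

Definition letter_opp (n : nat) (x : signed_letter n) : signed_letter n :=
  (x.1, ~~ x.2).

Definition weylC (n : nat) : {set {perm signed_letter n}} :=
  [set w : {perm signed_letter n} |
    [forall x, w (letter_opp x) == letter_opp (w x)]].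

(* w_i for 1 <= i <= n, and 0 at i = 0; the value 0 at i > n is not used. *)
Definition signed_word (n : nat) (w : {perm signed_letter n}) (i : nat) : int :=
  if i is j.+1 then
    oapp (fun k : 'I_n => letter_val (w (k, false))) 0 (insub j)
  else 0.

Definition affine_des (n : nat) (w : {perm signed_letter n}) : {set 'I_n.+1} :=
  [set i : 'I_n.+1 |
    if val i is j.+1 then signed_word w j.+1 < signed_word w j
    else 0 < signed_word w n].

(* 'X_i is t_i, for 0 <= i <= n. *)
Definition affine_eulerianC (R : comNzRingType) (n : nat) : {mpoly R[n.+1]} :=
  \sum_(w in weylC n) \prod_(i in affine_des w) 'X_i.

(* u_i for 1 <= i <= n; 'S_n acts on {0, ..., n - 1}, hence the shifts.  The
   value is 0 at i = 0 and at i = n + 1. *)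
Definition perm_word (n : nat) (u : 'S_n) (i : nat) : nat :=
  if i is j.+1 then oapp (fun k : 'I_n => (u k).+1) 0%N (insub j) else 0%N.

(* t_j, for 0 <= j <= n + 1, in the polynomial ring in t_0, ..., t_(n + 1). *)
Definition tvar (R : comNzRingType) (n : nat) (j : nat) : {mpoly R[n.+2]} :=
  'X_(inord j).

(* The substitution t_0 := t_(n + 1), t_i := t_i for 1 <= i <= n. *)
Definition rename_t0 (R : comNzRingType) (n : nat) :
    n.+1.-tuple {mpoly R[n.+2]} :=
  [tuple if val i == 0%N then tvar R n n.+1 else tvar R n (val i) | i < n.+1].

(* Main.v *)
(** Write a signed permutation as [w_i = ± u_i] with [u] in [S_n] and an arbitrary
    choice of signs.  With [w_0 = w_(n+1) = 0], there is a descent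
    [w_(i-1) > w_i] exactly when either [w_i < 0] and [u_(i-1) < u_i], or
    [w_(i-1) > 0] and [u_(i-1) > u_i].  So the larger of two neighbouring letters
    decides, and each letter [u_i] contributes on its own: [t_i] if it is negative
    and larger than its left neighbour, [t_(i+1)] if it is positive and larger
    than its right neighbour.  Summing over the signs factors into a product. *)
Require Import Defs.
From mathcomp Require Import zify.
Import Order.TTheory GRing.Theory Num.Theory.
Local Open Scope ring_scope.

(** The number of larger absolute value decides by its sign. Equality must be excluded: [- a < a]
    can hold with neither absolute value larger. *)
Lemma ltr_signed_nat (s t : bool) (a b : nat) : a != b ->
  ((-1) ^+ t * b%:Z < (-1) ^+ s * a%:Z) = (t && (a < b)%N) || (~~ s && (b < a)%N).
Proof. by case: s; case: t; rewrite ?expr1 ?expr0 /=; lia. Qed.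

Section SignedPerm.

Variable n : nat.
Implicit Types (u : 'S_n) (s : {ffun 'I_n -> bool}).

Definition signed_perm_fun (p : 'S_n * {ffun 'I_n -> bool})
    (x : signed_letter n) : signed_letter n := (p.1 x.1, x.2 (+) p.2 x.1).

Lemma signed_perm_fun_inj p : injective (signed_perm_fun p).
Proof.
move=> [k b] [l c] [/perm_inj /= ->] /(congr1 (addb^~ (p.2 l))).
by rewrite !addbK => ->.
Qed.

Definition signed_perm p : {perm signed_letter n} :=
  perm (@signed_perm_fun_inj p).

Lemma signed_perm_inj : injective signed_perm.
Proof.
move=> [u s] [v t] /permP E; congr pair.
  by apply/permP => k; have := E (k, false); rewrite !permE => -[].
by apply/ffunP => k; have := E (k, false); rewrite !permE => -[].
Qed.

Lemma weylC_signed_perm : weylC n = [set signed_perm p | p in setT].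
Proof.
apply/setP => w; rewrite inE; apply/forallP/imsetP => [wN | [p _ ->] x]; last first.
  by rewrite !permE /signed_perm_fun /letter_opp /= addNb.
have wE k b : w (k, b) = ((w (k, false)).1, b (+) (w (k, false)).2).
  case: b; last by case: (w _).
  exact: (eqP (wN (k, false))).
have abs_inj : injective (fun k => (w (k, false)).1).
  (* Feeding [w] the letter [k] with the sign of its own image makes the result positive, so equal
     absolute values give equal images. *)
  move=> k l E.
  have : w (k, (w (k, false)).2) = w (l, (w (l, false)).2).
    by rewrite wE [in RHS]wE !addbb E.
  by move=> /perm_inj [].
exists (perm abs_inj, [ffun k => (w (k, false)).2]) => //.
by apply/permP => -[k b]; rewrite wE permE /signed_perm_fun /= permE ffunE.
Qed.

Definition sign_word s (i : nat) : bool :=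
  if i is j.+1 then oapp s false (insub j) else false.

Lemma signed_wordE u s i :
  signed_word (signed_perm (u, s)) i = (-1) ^+ sign_word s i * (perm_word u i)%:Z.
Proof.
case: i => [|j] /=; first by rewrite mulr0.
by case: insubP => [k _ _ | _] /=; rewrite ?mulr0 // permE.
Qed.

Lemma perm_wordS u (i : 'I_n) : perm_word u i.+1 = (u i).+1.
Proof. by rewrite /= valK. Qed.

Lemma perm_word_out u : perm_word u n.+1 = 0%N.
Proof. by rewrite /= insubF ?ltnn. Qed.

Lemma perm_word_neq u i : (i < n)%N -> perm_word u i != perm_word u i.+1.
Proof.
move=> lt_in; rewrite (perm_wordS u (Ordinal lt_in)).
case: i lt_in => [//|j] lt_jn.
rewrite (perm_wordS u (Ordinal (ltnW lt_jn))) eqSS val_eqE (inj_eq perm_inj).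
by rewrite -val_eqE /= neq_ltn ltnSn.
Qed.

Lemma prod_affine_des (R : comNzRingType) (t : nat -> R) u s :
  \prod_(i in affine_des (signed_perm (u, s)))
     (if val i == 0%N then t n.+1 else t (val i)) =
  \prod_(i < n) (if s i then t i.+1 ^+ (perm_word u i < perm_word u i.+1)%N
                 else t i.+2 ^+ (perm_word u i.+2 < perm_word u i.+1)%N).
Proof.
set a := perm_word u.
(* [up i] and [dn i] are the contributions of the letter [i] to its left and to
   its right; [dn 0 = 1] because the letter [0] is never the larger one. *)
pose up i := t i.+1 ^+ (sign_word s i.+1 && (a i < a i.+1))%N.
pose dn i := t i.+1 ^+ (~~ sign_word s i && (a i.+1 < a i))%N.
transitivity ((\prod_(i < n) (up i * dn i)) * dn n).
  (* Index 0 is split off: its condition [0 < w_n] is a descent from [w_n] to [w_(n+1) = 0], which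
     is [dn n]. *)
  rewrite big_mkcond big_ord_recl [RHS]mulrC; congr (_ * _).
    rewrite inE [val _]/= signed_wordE /dn /a perm_word_out.
    case: (sign_word s n) => /=; first by rewrite mulN1r oppr_gt0.
    by rewrite expr0 mul1r ltz_nat; case: ltnP.
  apply: eq_bigr => i _; rewrite inE [val _]lift0 !signed_wordE.
  rewrite ltr_signed_nat ?perm_word_neq // [_ == _]/=.
  (* At most one of the two exponents is 1, so their sum still encodes the disjunction. *)
  rewrite /up /dn -/a -exprD.
  have := perm_word_neq u _ (ltn_ord i); rewrite -/a.
  by case: (sign_word s i.+1); case: (sign_word s i); case: ltngtP.
have dn_shift : \prod_(i < n) dn i * dn n = \prod_(i < n) dn i.+1.
  transitivity (\prod_(i < n.+1) dn i); first by rewrite big_ord_recr.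
  by rewrite big_ord_recl {1}/dn /= expr0 mul1r.
rewrite big_split -mulrA dn_shift -big_split; apply: eq_bigr => i _ /=.
by rewrite /up /dn /= valK /=; case: (s i); rewrite /= ?expr0 ?mulr1 ?mul1r.
Qed.

End SignedPerm.

Theorem proposition5p3 (R : comNzRingType) (n : nat) (hn : (1 <= n)%N) :
  comp_mpoly (rename_t0 R n) (affine_eulerianC R n) =
  \sum_(u : 'S_n) \prod_(1 <= i < n.+1)
    (tvar R n i ^+ (perm_word u i.-1 < perm_word u i)%N
     + tvar R n i.+1 ^+ (perm_word u i.+1 < perm_word u i)%N).
Proof.
rewrite /affine_eulerianC rmorph_sum /= weylC_signed_perm.
rewrite big_imset /=; last by move=> p q _ _; apply: signed_perm_inj.
rewrite (eq_bigl predT) => [|p]; last exact: in_setT.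
under [RHS]eq_bigr => u _.
  rewrite big_add1 big_mkord.
  under eq_bigr => i _.
    (* Each binomial becomes a sum over the sign of the letter [u_i]; distributivity then yields a
       sum over all sign functions. *)
    rewrite -(big_bool _ (fun b : bool => if b
      then tvar R n i.+1 ^+ (perm_word u i < perm_word u i.+1)%N
      else tvar R n i.+2 ^+ (perm_word u i.+2 < perm_word u i.+1)%N)).
    over.
  rewrite bigA_distr_bigA; over.
rewrite pair_bigA; apply: eq_bigr => -[u s] _ /=.
rewrite rmorph_prod -(@prod_affine_des n _ (tvar R n)).
by apply: eq_bigr => i _; rewrite /= comp_mpolyXU -tnth_nth tnth_mktuple.
Qed.
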